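(* Let $\rho\in(0,\pi)$ and $h>0$. Let $P$ be a probability measure on $\mathbb{R}^d$ that is absolutely continuous with respect to the Lebesgue measure $\mu$. Then: (a) The class $\mathcal{C}^U_{\rho,h}$ of nonempty closed sets $S\subset\mathbb{R}^d$ such that for every $x\in\partial S$ there is a unit vector $\xi$ with $C_{\rho,\xi,h}(x)\subset S^c$ is a $P$-uniformity class (and in particular a $P$-Glivenko--Cantelli class). (b) The class $\tilde{\mathcal{C}}^U_{\rho,h}$ of closed sets $S\subset\mathbb{R}^d$ such that $S$ equals the intersection of the complements of all the cones $C_{\rho,\xi,h}(y)$ ($y\in\mathbb{R}^d$, $\|\xi\|=1$) which satisfy $C_{\rho,\xi,h}(y)\cap S=\varnothing$ is a $P$-uniformity class (and in particular a $P$-Glivenko--Cantelli class).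
   Context: $B(x,h)$ denotes the open Euclidean ball in $\mathbb{R}^d$. For $x\in\mathbb{R}^d$, a unit vector $\xi$, an opening angle $\rho\in(0,\pi]$ and $h>0$, the finite open cone is $$C_{\rho,\xi,h}(x)=B(x,h)\cap\Big\{z\in\mathbb{R}^d,\ z\ne x:\ \Big\langle \xi,\frac{z-x}{\|z-x\|}\Big\rangle>\cos(\rho/2)\Big\}.$$ A class $\mathcal{A}$ of Borel subsets of $\mathbb{R}^d$ is a $P$-uniformity class if $\sup_{A\in\mathcal{A}}|P_n(A)-P(A)|\to 0$ for every sequence $(P_n)$ of probability measures converging weakly to $P$. It is a $P$-Glivenko--Cantelli class if $\sup_{A\in\mathcal{A}}|\mathbb{P}_n(A)-P(A)|\to 0$ almost surely, where $\mathbb{P}_n$ is the empirical distribution of the first $n$ terms of a sequence $X_1,X_2,\ldots$ of i.i.d. random variables with distribution $P$. *)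

(* Defs.v *)
From HB Require Import structures.
From mathcomp Require Import all_boot all_order all_algebra.
From mathcomp Require Import finmap.
From mathcomp Require Import all_classical all_reals all_analysis.

Set Implicit Arguments.
Unset Strict Implicit.
Unset Printing Implicit Defensive.
Import Order.TTheory GRing.Theory Num.Theory.
Import numFieldNormedType.Exports.

Local Open Scope classical_set_scope.
Local Open Scope ring_scope.

(* R^d is 'rV[R]_d. The topology of the library on this type is the product
   topology, i.e. the Euclidean one, but its norm `|x| and its [ball] are those
   of the sup norm; hence the explicit Euclidean inner product and norm. *)

Definition dotv (R : realType) (d : nat) (u v : 'rV[R]_d) : R :=
  \sum_(i < d) u ord0 i * v ord0 i.

Definition enorm (R : realType) (d : nat) (u : 'rV[R]_d) : R :=
  Num.sqrt (dotv u u).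

Definition eball (R : realType) (d : nat) (x : 'rV[R]_d) (h : R) :
    set 'rV[R]_d :=
  [set z | enorm (z - x) < h].

Definition cone (R : realType) (d : nat) (rho : R) (xi : 'rV[R]_d) (h : R)
    (x : 'rV[R]_d) : set 'rV[R]_d :=
  eball x h `&`
  [set z | z != x /\
           cos (rho / 2) < dotv xi ((enorm (z - x))^-1 *: (z - x))].

Definition boundary (T : topologicalType) (S : set T) : set T :=
  closure S `\` interior S.

Definition cone_class (R : realType) (d : nat) (rho h : R) :
    set (set 'rV[R]_d) :=
  [set S | [/\ S !=set0, closed S &
    forall x, boundary S x ->
      exists2 xi : 'rV[R]_d, enorm xi = 1 & cone rho xi h x `<=` ~` S]].

Definition cone_hull_class (R : realType) (d : nat) (rho h : R) :
    set (set 'rV[R]_d) :=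
  [set S | closed S /\
    S = \bigcap_(yxi in [set yxi : 'rV[R]_d * 'rV[R]_d |
                   enorm yxi.2 = 1 /\ cone rho yxi.2 h yxi.1 `&` S = set0])
          ~` cone rho yxi.2 h yxi.1].

Notation borelRd R d := (g_sigma_algebraType (@open 'rV[R]_d)).

Definition box (R : realType) (d : nat) (a b : 'rV[R]_d) : set 'rV[R]_d :=
  [set x | forall i : 'I_d, a ord0 i < x ord0 i <= b ord0 i].

(* The infimum of the total volume of the countable covers by half-open boxes:
   this is Lebesgue outer measure, and its restriction to the Borel sets is
   Lebesgue measure (for 0 < d). *)
Definition lebesgueRd (R : realType) (d : nat) (A : set (borelRd R d)) :
    \bar R :=
  ereal_inf [set (\sum_(0 <= k <oo)
                    (\prod_(i < d) (ab.2 k ord0 i - ab.1 k ord0 i))%:E)%E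
            | ab in [set ab : (nat -> 'rV[R]_d) * (nat -> 'rV[R]_d) |
                (forall k i, ab.1 k ord0 i <= ab.2 k ord0 i) /\
                A `<=` \bigcup_k box (ab.1 k) (ab.2 k)]].

Definition weakly_converges (R : realType) (d : nat)
    (Pn : nat -> probability (borelRd R d) R)
    (P : probability (borelRd R d) R) : Prop :=
  forall f : 'rV[R]_d -> R, continuous f -> bounded_fun f ->
    (\int[Pn n]_x (f x)%:E @[n --> \oo] --> \int[P]_x (f x)%:E)%E.

(* For a nonempty class; the supremum over the empty class would be -oo. *)
Definition sup_deviation (R : realType) (d : nat)
    (C : set (set 'rV[R]_d)) (m1 m2 : set (borelRd R d) -> \bar R) : \bar R :=
  ereal_sup [set `|m1 A - m2 A|%E | A in C].

Definition uniformity_class (R : realType) (d : nat)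
    (P : probability (borelRd R d) R) (C : set (set 'rV[R]_d)) : Prop :=
  (forall A : set (borelRd R d), C A -> measurable A) /\
  forall Pn : nat -> probability (borelRd R d) R,
    weakly_converges Pn P -> sup_deviation C (Pn n) P @[n --> \oo] --> 0%E.

Definition mutually_independent (R : realType) (d : nat)
    (dO : measure_display) (Omega : measurableType dO)
    (Q : probability Omega R) (X : nat -> {RV Q >-> borelRd R d}) : Prop :=
  forall (J : {fset nat}) (A : nat -> set (borelRd R d)),
    (forall i, measurable (A i)) ->
    Q (\bigcap_(i in [set` J]) (X i @^-1` A i)) =
    (\prod_(i <- J) Q (X i @^-1` A i))%E.

Definition iid_with_law (R : realType) (d : nat)
    (dO : measure_display) (Omega : measurableType dO)
    (Q : probability Omega R) (X : nat -> {RV Q >-> borelRd R d})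
    (P : probability (borelRd R d) R) : Prop :=
  mutually_independent X /\
  forall i (A : set (borelRd R d)), measurable A ->
    distribution Q (X i) A = P A.

(* Takes the junk value 0 for n = 0, which no limit in n sees. *)
Definition empirical (R : realType) (d : nat) (x : nat -> borelRd R d)
    (n : nat) (A : set (borelRd R d)) : \bar R :=
  ((n%:R^-1)%:E * \sum_(i < n) \d_(x i) A)%E.

Definition glivenko_cantelli_class (R : realType) (d : nat)
    (P : probability (borelRd R d) R) (C : set (set 'rV[R]_d)) : Prop :=
  (forall A : set (borelRd R d), C A -> measurable A) /\
  forall (dO : measure_display) (Omega : measurableType dO)
    (Q : probability Omega R) (X : nat -> {RV Q >-> borelRd R d}),
    iid_with_law X P ->
    {ae Q, forall w,
      sup_deviation C (empirical (fun i => X i w) n) P @[n --> \oo] --> 0%E}.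

(* Main.v *)
(* Each set [S] of either class has the following property: between any point
   of [S] and any point off [S] there is the apex of a cone missing [S], of an
   opening and a height depending on [rho] and [h] only. For the first class the
   apex is a boundary point; for the second one, a point of a finite cone missing
   [S] is itself, by convexity, the apex of a smaller cone inside that cone.

   Cut the box [-b, b]^d into cells of side 1/n. If a cell contains points of [S]
   and of its complement, then its translates by the multiples i v, 1 <= i <= m, of
   an integer vector v of bounded size along the axis of the cone do not meet [S].
   As there are boundedly many such v, pigeonhole bounds the number of these cells
   by O(n^d / m), where m is proportional to n, so they have a Lebesgue measure
   O(1 / n) uniformly in [S], hence a uniformly small [P]-measure. The unions of
   cells meeting [S] or its complement thus form finitely many closed brackets,
   and it only remains to bound limsup Pn(V) by P(V) for these closed sets [V]: by
   a Urysohn function under weak convergence, and by the strong law of large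
   numbers for indicators (Chebyshev along the squares) for the empirical
   measures. *)
Require Import Defs.
From mathcomp Require Import all_boot all_order all_algebra.
From mathcomp Require Import finmap.
From mathcomp Require Import all_classical all_reals all_analysis.
From mathcomp Require Import measurable_realfun.
From mathcomp Require Import ring lra zify.
Import Order.TTheory GRing.Theory Num.Theory.
Import numFieldNormedType.Exports.
Local Open Scope classical_set_scope.
Local Open Scope ring_scope.

(** * Cones *)

Section euclidean.
Context {R : realType} {d : nat}.
Implicit Types (u v w : 'rV[R]_d) (a : R).

Lemma dotvC u v : dotv u v = dotv v u.
Proof. by apply: eq_bigr => i _; rewrite mulrC. Qed.

Lemma dotvDr u v w : dotv u (v + w) = dotv u v + dotv u w.
Proof. by rewrite -big_split; apply: eq_bigr => i _; rewrite mxE mulrDr. Qed.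

Lemma dotvZr a u v : dotv u (a *: v) = a * dotv u v.
Proof. by rewrite mulr_sumr; apply: eq_bigr => i _; rewrite mxE mulrCA. Qed.

Lemma dotvDl u v w : dotv (v + w) u = dotv v u + dotv w u.
Proof. by rewrite dotvC dotvDr !(dotvC u). Qed.

Lemma dotvZl a u v : dotv (a *: u) v = a * dotv u v.
Proof. by rewrite dotvC dotvZr dotvC. Qed.

Lemma dotv_ge0 u : 0 <= dotv u u.
Proof. by apply: sumr_ge0 => i _; rewrite -expr2 sqr_ge0. Qed.

Lemma enorm_ge0 u : 0 <= enorm u. Proof. exact: sqrtr_ge0. Qed.

Lemma sqr_enorm u : enorm u ^+ 2 = dotv u u.
Proof. by rewrite sqr_sqrtr ?dotv_ge0. Qed.

Lemma coord_le_enorm u i : `|u ord0 i| <= enorm u.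
Proof.
rewrite -sqrtr_sqr ler_sqrt ?dotv_ge0// /dotv (bigD1 i)//= -expr2 lerDl.
by apply: sumr_ge0 => j _; rewrite -expr2 sqr_ge0.
Qed.

Lemma enorm_eq0 u : (enorm u == 0) = (u == 0).
Proof.
apply/eqP/eqP => [u0|->].
  apply/rowP => i; apply/eqP; rewrite mxE -normr_le0 -u0.
  exact: coord_le_enorm.
by rewrite /enorm /dotv big1 ?sqrtr0// => i _; rewrite mxE mul0r.
Qed.

Lemma enormZ a u : enorm (a *: u) = `|a| * enorm u.
Proof.
by rewrite /enorm dotvZl dotvZr mulrA -expr2 sqrtrM ?sqr_ge0// sqrtr_sqr.
Qed.

Lemma dotv_le_enorm u v : dotv u v <= enorm u * enorm v.
Proof.
have [u0|u0] := eqVneq u 0.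
  rewrite u0 /dotv big1 ?mulr_ge0 ?enorm_ge0// => i _.
  by rewrite mxE mul0r.
have [v0|v0] := eqVneq v 0.
  rewrite v0 /dotv big1 ?mulr_ge0 ?enorm_ge0// => i _.
  by rewrite mxE mulr0.
have nu : 0 < enorm u by rewrite lt0r enorm_eq0 u0 enorm_ge0.
have nv : 0 < enorm v by rewrite lt0r enorm_eq0 v0 enorm_ge0.
have := dotv_ge0 (enorm v *: u + (- enorm u) *: v).
rewrite !(dotvDl, dotvDr, dotvZl, dotvZr) -!sqr_enorm (dotvC v u).
rewrite (_ : _ + _ = 2 * (enorm u * enorm v) * (enorm u * enorm v - dotv u v)).
  by rewrite pmulr_rge0 ?subr_ge0// !mulr_gt0.
ring.
Qed.

Lemma enormD u v : enorm (u + v) <= enorm u + enorm v.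
Proof.
rewrite -(@ler_pXn2r _ 2)// ?nnegrE ?addr_ge0 ?enorm_ge0//.
rewrite sqrrD !sqr_enorm dotvDl !dotvDr (dotvC v u).
by have := dotv_le_enorm u v; lra.
Qed.

Lemma enorm_le_sum u : enorm u <= \sum_(i < d) `|u ord0 i|.
Proof.
rewrite -(@ler_pXn2r _ 2)// ?nnegrE ?enorm_ge0//; last exact: sumr_ge0.
rewrite sqr_enorm [leRHS]expr2 mulr_suml ler_sum// => i _.
rewrite (le_trans (ler_norm _))// normrM ler_wpM2l// (bigD1 i)//=.
by rewrite lerDl sumr_ge0.
Qed.

(** At [z = x] both sides of the last inequality vanish, so its strictness already excludes the
    apex; elsewhere one multiplies by the norm. *)
Lemma coneP (rho h : R) (xi x z : 'rV[R]_d) : 0 <= cos (rho / 2) ->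
  cone rho xi h x z <->
  enorm (z - x) < h /\ cos (rho / 2) * enorm (z - x) < dotv xi (z - x).
Proof.
move=> k0; split=> [[zh [zx]]|[zh kz]].
  have n0 : 0 < enorm (z - x).
    by rewrite lt0r enorm_eq0 subr_eq0 zx enorm_ge0.
  by move=> kz; split=> //; move: kz; rewrite dotvZr ltr_pdivlMl// mulrC.
have zx : z != x.
  apply: contraTneq kz => ->; rewrite subrr.
  have -> : enorm (0 : 'rV[R]_d) = 0 by apply/eqP; rewrite enorm_eq0.
  by rewrite mulr0 /dotv big1 ?ltxx// => i _; rewrite mxE mulr0.
split => //; split => //.
have n0 : 0 < enorm (z - x).
  by rewrite lt0r enorm_eq0 subr_eq0 zx enorm_ge0.
by rewrite dotvZr ltr_pdivlMl// mulrC.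
Qed.

(* A finite cone is convex and contains the ball of this radius about
   [y + (h / 2) xi], hence all convex combinations of that ball and [x]. *)
Lemma cone_starlike (rho h : R) (xi x y w : 'rV[R]_d) (t : R) :
  let k := cos (rho / 2) in
  0 <= k -> 0 < h -> enorm xi = 1 ->
  enorm (x - y) < h -> k * enorm (x - y) <= dotv xi (x - y) ->
  enorm w < h / 2 * ((1 - k) / (1 + k)) -> 0 < t <= 1 ->
  cone rho xi h y (x + t *: (y + (h / 2) *: xi - x) + t *: w).
Proof.
move=> k k0 h0 xi1 xyh kxy wr /andP[t0 t1]; apply/coneP => //.
rewrite -/k.
have -> : x + t *: (y + (h / 2) *: xi - x) + t *: w - y =
    (1 - t) *: (x - y) + t *: ((h / 2) *: xi + w).
  by apply/rowP => i; rewrite !mxE; ring.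
have k1 : 0 < 1 + k by lra.
(* Equivalently k (h/2 + |w|) < h/2 - |w|: the angle condition on the ball, in the worst case where
   the inner product of [xi] and [w] is -|w|. The radius is chosen for this. *)
have wk : enorm w * (1 + k) < h / 2 * (1 - k).
  by move: wr; rewrite mulrA ltr_pdivlMr.
have n0 := enorm_ge0 w.
have nhw : enorm ((h / 2) *: xi + w) <= h / 2 + enorm w.
  rewrite (le_trans (enormD _ _))// enormZ xi1 mulr1 gtr0_norm//.
  by rewrite divr_gt0.
have nz : enorm ((1 - t) *: (x - y) + t *: ((h / 2) *: xi + w)) <=
    (1 - t) * enorm (x - y) + t * (h / 2 + enorm w).
  rewrite (le_trans (enormD _ _))// !enormZ ger0_norm ?subr_ge0//.
  by rewrite (gtr0_norm t0) lerD2l ler_pM2l.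
have wh : h / 2 + enorm w < h by nra.
split.
  apply: le_lt_trans nz _.
  have : t * (h / 2 + enorm w) < t * h by rewrite ltr_pM2l.
  have : (1 - t) * enorm (x - y) <= (1 - t) * h.
    by rewrite ler_wpM2l ?subr_ge0// ltW.
  lra.
apply: (le_lt_trans (ler_wpM2l k0 nz)).
rewrite dotvDr !dotvZr [dotv xi (_ *: _ + w)]dotvDr dotvZr -sqr_enorm xi1.
rewrite expr1n mulr1.
have xw : - enorm w <= dotv xi w.
  have := dotv_le_enorm xi ((-1) *: w).
  by rewrite dotvZr enormZ normrN normr1 xi1; lra.
have : (1 - t) * (k * enorm (x - y)) <= (1 - t) * dotv xi (x - y).
  by rewrite ler_wpM2l// subr_ge0.
have : t * (k * (h / 2 + enorm w)) < t * (h / 2 + dotv xi w).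
  by rewrite ltr_pM2l//; nra.
nra.
Qed.

End euclidean.

(** * Apexes of missing cones between a set and its complement *)

Section probe.
Context {R : realType} {d : nat}.
Implicit Types (S : set 'rV[R]_d) (rho h r K : R).

(* Between a point of [S] and a point off [S] there is an apex [x] of a cone
   missing [S]; the cone is encoded by the sup-norm balls of radius [t * r]
   about [x + t u], 0 < t <= 1. *)
Definition cone_separated r K S := forall a b, S a -> ~ S b ->
  exists x u : 'rV[R]_d, [/\
    exists2 s : R, 0 <= s <= 1 & x = a + s *: (b - a),
    forall i, `|u ord0 i| <= K &
    forall (t : R) (z : 'rV[R]_d), 0 < t <= 1 ->
      (forall i, `|z ord0 i - (x ord0 i + t * u ord0 i)| < t * r) -> ~ S z].

(** The radius of the Euclidean ball in [cone_starlike], divided by [d.+1]: the Euclidean norm is at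
    most the sum of the [d] coordinates, so a sup-norm ball of this radius lies strictly inside that
    ball. *)
Definition probe_radius rho h : R :=
  h / 2 * ((1 - cos (rho / 2)) / (1 + cos (rho / 2))) / d.+1%:R.

Lemma cos_half_angle rho : 0 < rho < pi -> 0 <= cos (rho / 2) < 1.
Proof.
move=> /andP[rho0 rhopi]; apply/andP; split.
  by rewrite ltW// cos_gt0_pihalf//; lra.
by rewrite -[ltRHS]cos0 ltr_cos ?in_itv/= ?lexx ?pi_ge0//; lra.
Qed.

Let sector_ball_gt0 rho h : 0 <= cos (rho / 2) < 1 -> 0 < h ->
  0 < h / 2 * ((1 - cos (rho / 2)) / (1 + cos (rho / 2))).
Proof. by move=> /andP[k0 k1] h0; rewrite !(mulr_gt0, invr_gt0)//; lra. Qed.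

Lemma probe_radius_gt0 rho h : 0 < rho < pi -> 0 < h -> 0 < probe_radius rho h.
Proof. by move=> /cos_half_angle k h0; rewrite divr_gt0// sector_ball_gt0. Qed.

(** The angle condition on [x] is non-strict so as to cover both uses: [x] a point of the cone, and
    [x] its apex [y]. *)
Lemma cone_probe rho h S (xi x y : 'rV[R]_d) :
  0 <= cos (rho / 2) < 1 -> 0 < h -> enorm xi = 1 ->
  enorm (x - y) < h -> cos (rho / 2) * enorm (x - y) <= dotv xi (x - y) ->
  cone rho xi h y `<=` ~` S ->
  exists2 u : 'rV[R]_d, forall i, `|u ord0 i| <= 2 * h &
    forall (t : R) (z : 'rV[R]_d), 0 < t <= 1 ->
      (forall i, `|z ord0 i - (x ord0 i + t * u ord0 i)| <
                 t * probe_radius rho h) -> ~ S z.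
Proof.
move=> /andP[k0 k1] h0 xi1 xyh kxy coneS; exists (y + (h / 2) *: xi - x).
  move=> i; rewrite (le_trans (coord_le_enorm _ _))//.
  have -> : y + (h / 2) *: xi - x = (h / 2) *: xi + (-1) *: (x - y).
    by apply/rowP => j; rewrite !mxE; ring.
  rewrite (le_trans (enormD _ _))// !enormZ xi1 normrN normr1.
  by rewrite gtr0_norm ?divr_gt0//; lra.
move=> t z t01 zt; have /andP[t0 t1] := t01.
pose w := t^-1 *: (z - (x + t *: (y + (h / 2) *: xi - x))).
have -> : z = x + t *: (y + (h / 2) *: xi - x) + t *: w.
  by rewrite scalerA divff ?gt_eqF// scale1r addrC subrK.
apply: coneS; apply: cone_starlike => //.
rewrite (le_lt_trans (enorm_le_sum _))//.
apply: (@le_lt_trans _ _ (\sum_(i < d) probe_radius rho h)).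
  apply: ler_sum => i _; rewrite ltW// mxE normrM gtr0_norm ?invr_gt0//.
  by rewrite ltr_pdivrMl//; move: (zt i); rewrite !mxE.
rewrite sumr_const card_ord -[ltLHS]mulr_natr /probe_radius.
rewrite mulrAC -mulrA gtr_pMr ?sector_ball_gt0 ?k0//.
by rewrite ltr_pdivrMr ?ltr0Sn// mul1r ltr_nat.
Qed.

(** As [S] is an intersection of complements of cones, [b] lies in a cone missing [S] and is itself
    the required apex, with [s = 1]. *)
Lemma cone_hull_class_separated rho h S : 0 < rho < pi -> 0 < h ->
  cone_hull_class rho h S -> cone_separated (probe_radius rho h) (2 * h) S.
Proof.
move=> /cos_half_angle k01 h0 [_ defS] a b _ nSb.
have : (~` S) b by [].
rewrite {1}defS setC_bigcap => -[[y xi] /= [xi1 yS]].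
move=> /contrapT yb.
have /andP[k0 _] := k01.
have /(coneP _ _ _ _ _ k0)[byh kby] := yb.
have [|u uh uS] := cone_probe _ _ S xi b y k01 h0 xi1 byh (ltW kby).
  exact/disjoints_subset.
exists b, u; split => //.
by exists 1; rewrite ?lexx ?ler01// scale1r addrC subrK.
Qed.

(** If the segment avoided the boundary, the preimage of [S] in [0, 1] would also be that of its
    interior, hence nonempty, open and closed; by connectedness it would contain 1, the parameter of
    [b]. *)
Lemma boundary_segment S (a b : 'rV[R]_d) : closed S -> S a -> ~ S b ->
  exists2 s : R, 0 <= s <= 1 & boundary S (a + s *: (b - a)).
Proof.
move=> clS Sa nSb; apply: contrapT => nbd.
pose f (s : R) : 'rV[R]_d := a + s *: (b - a).
have cf : continuous f.
  by move=> s; exact: (cvgD (cvg_cst a) (@scalel_continuous _ _ (b - a) s)).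
pose B := `[0, 1]%classic `&` f @^-1` S.
have BE : B = `[0, 1]%classic.
  have := @segment_connected R 0 1; apply.
  - by exists 0; split; rewrite /= ?in_itv/= ?lexx ?ler01// /f scale0r addr0.
  - exists (f @^-1` interior S).
      by apply: open_comp => [x _|]; [exact: cf|exact: open_interior].
    apply/seteqP; split => s [s01 fs]; split => //;
      last exact: (interior_subset fs).
    apply: contrapT => nfs; apply: nbd; exists s.
      by move: s01; rewrite /= in_itv.
    by split => //; exact: subset_closure.
  - exists (f @^-1` S) => //.
    by apply: preimage_closed => // x _; exact: cf.
have : B 1 by rewrite BE /= in_itv/= ler01 lexx.
by case=> _; rewrite /f /= scale1r addrC subrK.
Qed.

Lemma cone_class_separated rho h S : 0 < rho < pi -> 0 < h ->
  cone_class rho h S -> cone_separated (probe_radius rho h) (2 * h) S.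
Proof.
move=> /cos_half_angle k01 h0 [_ clS coneS] a b Sa nSb.
have [s s01 /[dup] bdx /coneS[xi xi1 xiS]] := boundary_segment _ _ _ clS Sa nSb.
set x := a + _ in bdx xiS.
have e0 : enorm (x - x) = 0 by apply/eqP; rewrite enorm_eq0 subrr.
have [| |u uh uS] := cone_probe _ _ S xi x x k01 h0 xi1 _ _ xiS.
- by rewrite e0.
- by rewrite e0 mulr0 subrr /dotv big1// => i _; rewrite mxE mulr0.
by exists x, u; split => //; exists s.
Qed.

End probe.

(** * Counting grid cells *)

Section grid.
Context {R : realType} {d : nat}.
Implicit Types (S : set 'rV[R]_d) (r K : R) (b n N m W L : nat).

(* The cell of index [k] in the grid of mesh [1 / n] with lowest corner
   [(- b, ..., - b)]. *)
Definition cell b n N (k : {ffun 'I_d -> 'I_N}) : set 'rV[R]_d :=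
  [set x | forall i, (k i)%:R / n%:R - b%:R <= x ord0 i <=
                     (k i).+1%:R / n%:R - b%:R].

Definition straddling b n N S : {set {ffun 'I_d -> 'I_N}} :=
  [set k : {ffun 'I_d -> 'I_N} |
    `[< cell b n _ k `&` S !=set0 /\ cell b n _ k `&` ~` S !=set0 >]].

Lemma cell_segment b n N (k : {ffun 'I_d -> 'I_N}) (x y : 'rV[R]_d)
    (s : R) : 0 <= s <= 1 ->
  cell b n _ k x -> cell b n _ k y -> cell b n _ k (x + s *: (y - x)).
Proof.
move=> /andP[s0 s1] kx ky i; have /andP[x0 x1] := kx i.
have /andP[y0 y1] := ky i; rewrite !mxE; apply/andP; split; nra.
Qed.

(** The integers from -W to W are encoded as [w - W] with [w] an ordinal; [w] is the integer part of
    [L a + W]. *)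
Lemma round_step L W (a K : R) : `|a| <= K -> L%:R * K <= W%:R ->
  exists w : 'I_(2 * W).+1, `|w%:R - W%:R - L%:R * a| <= 1.
Proof.
move=> aK LKW.
have LaW : `|L%:R * a| <= W%:R.
  by rewrite normrM normr_nat (le_trans _ LKW)// ler_wpM2l.
have /andP[W0 W1] : - W%:R <= L%:R * a <= W%:R by rewrite -ler_norml.
have := @truncn_itv R (L%:R * a + W%:R).
rewrite -lerBlDr sub0r => /(_ W0) /andP[t0 t1].
have tW : (Num.truncn (L%:R * a + W%:R) < (2 * W).+1)%N.
  by rewrite ltnS -(@ler_nat R) (le_trans t0)// natrM; lra.
exists (Ordinal tW); rewrite /= ler_norml; apply/andP.
by move: t1; rewrite -[in X in X -> _]natr1 => t1; split; lra.
Qed.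

(* Moving the cell by the [i]-th multiple of the rounded step keeps it inside
   the cone, as long as the cone is [i * L / n <= 1] long. *)
Lemma straddling_step r K b n N m W L S (k : {ffun 'I_d -> 'I_N}) :
  cone_separated r K S -> 2 < L%:R * r -> L%:R * K <= W%:R ->
  (0 < n)%N -> (m * L <= n)%N -> k \in straddling b n N S ->
  exists w : {ffun 'I_d -> 'I_(2 * W).+1},
    forall (i : nat) (k' : {ffun 'I_d -> 'I_N}), (0 < i <= m)%N ->
      (forall j, (k' j + i * W = k j + i * w j)%N) ->
      k' \notin straddling b n N S.
Proof.
move=> sepS Lr LKW n0 mLn; rewrite inE => /asboolP[[a [ka Sa]] [c [kc nSc]]].
have [x [u [[s s01 xE] uK uS]]] := sepS _ _ Sa nSc.
have kx : cell b n _ k x by rewrite xE; exact: cell_segment.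
have [w wP] := choice (fun j => round_step L W (u ord0 j) K (uK j) LKW).
exists (finfun w) => i k' /andP[i0 im] kk'; rewrite inE; apply/asboolPn.
move=> [[z [k'z Sz]] _].
have nR : 0 < n%:R :> R by rewrite ltr0n.
have iR : 1 <= i%:R :> R by rewrite ler1n.
(* The cone is probed at [t = i L / n], which is at most 1 because [m L <= n]. *)
apply: (uS (i%:R * L%:R / n%:R) z _ _ Sz).
  have L0 : (0 < L)%N by case: (L) Lr => //; rewrite mul0r; lra.
  rewrite divr_gt0 ?mulr_gt0 ?ltr0n//= ler_pdivrMr// mul1r -natrM ler_nat.
  by rewrite (leq_trans _ mLn)// leq_mul2r im orbT.
move=> j; have /andP[x0 x1] := kx j; have /andP[z0 z1] := k'z j.
have /eqP := kk' j; rewrite ffunE -(eqr_nat R) !natrD !natrM => /eqP kj.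
have := wP j; rewrite ler_norml => /andP[w0 w1].
set k1 := (k' j)%:R in kj z0 z1; set k0 := (k j)%:R in kj x0 x1.
rewrite -[in X in X / _] natr1 mulrDl mul1r in z1.
rewrite -[in X in X / _] natr1 mulrDl mul1r in x1.
rewrite -/k1 -/k0 in x1 z1.
have n1 : 0 < n%:R^-1 :> R by rewrite invr_gt0.
rewrite ltr_norml.
set e := n%:R^-1 in n1 x0 x1 z0 z1 *.
(* Error budget: rounding the step [i] times costs at most [i / n], the positions inside the two
   cells at most [1 / n]. The total is at most [2 i / n], which is less than [t r = i L r / n] since
   [2 < L r]. *)
have iw0 : - (i%:R * e) <= (i%:R * e) * ((w j)%:R - W%:R - L%:R * u ord0 j).
  by rewrite -[leLHS]mulrN1 ler_wpM2l// mulr_ge0// ltW// invr_gt0.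
have iw1 : (i%:R * e) * ((w j)%:R - W%:R - L%:R * u ord0 j) <= i%:R * e.
  by rewrite -[leRHS]mulr1 ler_wpM2l// mulr_ge0// ltW// invr_gt0.
have ee : e <= i%:R * e by rewrite ler_peMl// ltW.
have er : 2 * (i%:R * e) < i%:R * L%:R * e * r.
  rewrite (_ : _ * r = (L%:R * r) * (i%:R * e)); last ring.
  by rewrite ltr_pM2r// mulr_gt0// (lt_le_trans _ iR).
have kE : k1 * e = k0 * e + (i%:R * e) * ((w j)%:R - W%:R).
  by rewrite -[k1](addrK (i%:R * W%:R)) kj; ring.
move: iw0 iw1; rewrite mulrBr => iw0 iw1.
rewrite (_ : i%:R * L%:R * e * u ord0 j = (i%:R * e) * (L%:R * u ord0 j));
  last ring.
by apply/andP; split; lra.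
Qed.

(** Pigeonhole: a straddling cell together with a number of steps [i <= m] is determined by the step
    vector and the cell reached. Otherwise two straddling cells with the same vector would be
    translates of each other by a positive multiple of it, against [straddling_step]. *)
Lemma card_straddling r K b n N m W L S :
  cone_separated r K S -> 2 < L%:R * r -> L%:R * K <= W%:R ->
  (0 < n)%N -> (m * L <= n)%N ->
  (#|straddling b n N S| * m.+1 <=
   (2 * W).+1 ^ d * (N + 2 * (m * W)).+1 ^ d)%N.
Proof.
move=> sepS Lr LKW n0 mLn; set G := straddling b n N S.
have /choice[w wP] : forall k : {ffun 'I_d -> 'I_N},
    exists w : {ffun 'I_d -> 'I_(2 * W).+1}, k \in G ->
    forall (i : nat) (k' : {ffun 'I_d -> 'I_N}), (0 < i <= m)%N ->
      (forall j, (k' j + i * W = k j + i * w j)%N) -> k' \notin G.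
  move=> k; have [kG|_] := boolP (k \in G); last by exists [ffun=> ord0].
  have [w] := straddling_step _ _ _ _ _ _ _ _ _ k sepS Lr LKW n0 mLn kG.
  by exists w.
(* The coordinates of the cell reached, [k + i (w - W)], are shifted by [m W] to be natural numbers;
   they stay below [N + 2 m W], so [inord] truncates nothing. *)
pose phi (p : {ffun 'I_d -> 'I_N} * 'I_m.+1) :
    {ffun 'I_d -> 'I_(2 * W).+1} * {ffun 'I_d -> 'I_(N + 2 * (m * W)).+1} :=
  (w p.1, [ffun j => inord (p.1 j + p.2 * w p.1 j + (m - p.2) * W)]).
have phi_inj : {in finset.setX G [set: 'I_m.+1]%SET &, injective phi}.
  have shift (k k' : {ffun 'I_d -> 'I_N}) (i i' : 'I_m.+1) : (i <= i')%N ->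
      k' \in G -> k \in G -> phi (k, i) = phi (k', i') -> (k, i) = (k', i').
    move=> ii' k'G kG [ww] /ffunP E.
    have {}E j : (k j + i * w k j + (m - i) * W =
                  k' j + i' * w k j + (m - i') * W)%N.
      have := congr1 val (E j); rewrite !ffunE/= -ww.
      have := ltn_ord (k j); have := ltn_ord (k' j).
      have := ltn_ord (w k j); have := ltn_ord i; have := ltn_ord i'.
      move=> im im' wj kj k'j; rewrite !inordK//.
        by rewrite ltnS; nia.
      by rewrite ltnS; nia.
    have [/val_inj ii|ni] := eqVneq (i : nat) i'.
      rewrite -ii in E *; congr pair; apply/ffunP => j; apply: val_inj => /=.
      by have := E j; lia.
    (* Here [i < i'], and [k] is reached from [k'] in [i' - i] steps. *)
    have /negP[] : k \notin G => //.
    apply: (wP k' k'G (i' - i)%N k).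
      by have := ltn_ord i'; lia.
    move=> j; rewrite -ww; have := E j; have := ltn_ord i'; nia.
  move=> [k i] [k' i'] /finset.setXP[/= kG _] /finset.setXP[/= k'G _] E.
  have [ii'|/ltnW ii'] := leqP i i'; first exact: shift.
  by apply/esym/shift.
have := max_card (mem (phi @: finset.setX G [set: 'I_m.+1]%SET)).
rewrite card_in_imset// cardsX finset.cardsT card_ord => /leq_trans; apply.
by rewrite card_prod !card_ffun !card_ord.
Qed.

End grid.

(** * Lebesgue outer measure *)

Section lebesgue_outer.
Context {R : realType} {d : nat}.
Local Notation leb := (@lebesgueRd R d).

Let vol (p : 'rV[R]_d * 'rV[R]_d) : \bar R :=
  (\prod_(i < d) (p.2 ord0 i - p.1 ord0 i))%:E.

Lemma lebesgueRd_ge0 (A : set (borelRd R d)) : (0 <= leb A)%E.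
Proof.
apply/ereal_infP => _ [[a b] /= [ab _] <-]; apply: nneseries_ge0 => k _ _.
by rewrite lee_fin prodr_ge0// => i _; rewrite subr_ge0.
Qed.

Lemma le_lebesgueRd (A B : set (borelRd R d)) : A `<=` B -> (leb A <= leb B)%E.
Proof.
move=> AB; apply: ereal_inf_le_tmp => _ [ab [? Bab] <-]; exists ab => //.
by split => //; exact: subset_trans Bab.
Qed.

(** Countable subadditivity. The strict bounds give each [E j] a cover of volume at most [e j]; the
    covers are merged into one sequence along a bijection of [nat] with its square. *)
Lemma lebesgueRd_bigcup (E : nat -> set (borelRd R d)) (e : nat -> \bar R) :
  (forall j, leb (E j) < e j)%E -> (leb (\bigcup_j E j) <= \sum_(j <oo) e j)%E.
Proof.
move=> Ee.
have /choice[G PG] : forall j, exists G : nat -> 'rV[R]_d * 'rV[R]_d,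
    [/\ forall k i, (G k).1 ord0 i <= (G k).2 ord0 i,
        E j `<=` \bigcup_k box (G k).1 (G k).2 &
        (\sum_(0 <= k <oo) vol (G k) <= e j)%E].
  move=> j; have /ereal_inf_lt[_ [[a b] /= [ab Eab] <-] /ltW abe] := Ee j.
  by exists (fun k => (a k, b k)).
have vol0 j k : (0 <= vol (G j k))%E.
  by rewrite lee_fin prodr_ge0// => i _; rewrite subr_ge0; have [] := PG j.
have /card_esym/ppcard_eqP[f] := card_nat2.
pose H := uncurry G \o f.
have muG_ge0 x : (0 <= (vol \o uncurry G) x)%E by case: x => j k; exact: vol0.
apply: (@le_trans _ _ (\esum_(i in setT) (vol \o uncurry G) i)).
  apply: ereal_inf_lbound; exists (fst \o H, snd \o H).
    split => [k i|x [j _ Ejx]].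
      by rewrite /H /=; case: (f k) => j l /=; have [+ _ _] := PG j; apply.
    have [_ /(_ _ Ejx)[k _ xk] _] := PG j.
    by exists (f^-1%FUN (j, k)) => //=; rewrite /H/= invK ?inE.
  rewrite -(esum_pred_image (vol \o uncurry G) f xpredT) ?[fun=> _]set_true//.
  by rewrite image_eq.
rewrite (_ : esum _ _ = \sum_(i <oo) \sum_(j <oo) vol (G i j))%E; last first.
  pose J : nat -> set (nat * nat) := fun i => [set (i, j) | j in setT].
  rewrite (_ : setT = \bigcup_k J k); last first.
    by rewrite predeqE => -[a b]; split => // _; exists a => //; exists b.
  rewrite esum_bigcupT /=; last 2 first.
    - apply/trivIsetP => i j _ _ ij.
      rewrite predeqE => -[n m] /=; split => //= -[] [_] _ [<-{n} _].
      by move=> [m' _] [] /esym/eqP; rewrite (negbTE ij).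
    - by move=> /= [j k]; exact: vol0.
  rewrite -(image_id [set: nat]) -fun_true esum_pred_image//; last first.
    by move=> n _; apply: esum_ge0 => -[j k] _; exact: vol0.
  apply: eq_eseriesr => /= j _.
  rewrite -(esum_pred_image (vol \o uncurry G) (pair j) predT)//=; last first.
    by move=> ? ? _ _; exact: (@can_inj _ _ _ snd).
  by congr esum; rewrite predeqE => -[a b]; split; move=> [i _ <-]; exists i.
apply: lee_nneseries => [j _ _|j _]; first exact: nneseries_ge0.
by have [] := PG j.
Qed.

Lemma lebesgueRd_le_card (I : finType) (G : {set I}) (a b : I -> 'rV[R]_d)
    (c : R) : (0 < d)%N -> 0 <= c ->
  (forall k i, b k ord0 i = a k ord0 i + c) ->
  (leb (\bigcup_(k in [set k | k \in G]) box (a k) (b k)) <=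
   (#|G|%:R * c ^+ d)%:E)%E.
Proof.
move=> d0 c0 abc; pose s := [seq (a k, b k) | k in G].
have ss : size s = #|G| by rewrite size_map -cardE.
(* The finite cover is continued by the degenerate box [(0, 0)], whose volume [0 ^+ d] is zero
   because [0 < d]. *)
apply: (@le_trans _ _ (\sum_(0 <= j <oo) vol (nth (0%R, 0%R) s j))%E).
  apply: ereal_inf_lbound; exists ((fun j => (nth (0, 0) s j).1),
    (fun j => (nth (0, 0) s j).2)) => //=; split.
    move=> j i; have [js|js] := ltnP j (size s); last by rewrite nth_default.
    have /fintype.imageP[k _ ->] := mem_nth (0, 0) js.
    by rewrite abc lerDl.
  move=> x [k /= kG xk].
  have ks : (a k, b k) \in s by apply: fintype.image_f.
  by exists (index (a k, b k) s) => //; rewrite nth_index.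
have vol_s j : vol (nth (0, 0) s j) = if (j < #|G|)%N then (c ^+ d)%:E else 0%E.
  case: ltnP; rewrite -ss => js.
    have /fintype.imageP[k _ ->] := mem_nth (0, 0) js; rewrite /vol/=.
    under eq_bigr do rewrite abc addrC addKr.
    by rewrite prodr_const card_ord.
  rewrite nth_default// /vol/= (eq_bigr (fun=> 0)) ?prodr_const ?card_ord.
    by rewrite expr0n gtn_eqF.
  by move=> i _; rewrite subrr.
under eq_eseriesr do rewrite vol_s.
rewrite (nneseries_split _ #|G|); last first.
  by move=> k _; case: ifP => // _; rewrite lee_fin exprn_ge0.
rewrite [X in (_ + X)%E]eseries0 ?adde0; last first.
  by move=> j /=; rewrite add0n leqNgt => /negbTE ->.
rewrite add0n big_mkord (eq_bigr (fun=> (c ^+ d)%:E)); last first.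
  by move=> i _; rewrite ltn_ord.
by rewrite sumEFin sumr_const card_ord mulr_natl.
Qed.

(* As for measures, by Borel-Cantelli; [lebesgueRd] is only known to be an
   outer measure. *)
Lemma lebesgueRd_dominates (P : probability (borelRd R d) R) : P `<< leb ->
  forall e : R, 0 < e -> exists2 eta : R, 0 < eta &
    forall A, measurable A -> (leb A < eta%:E)%E -> (P A < e%:E)%E.
Proof.
move=> Pleb e e0; apply: contrapT => noeta.
have /choice[F PF] : forall n, exists A, [/\ measurable A,
    (leb A < (1 / (2 ^ n.+1)%:R)%:E)%E & (e%:E <= P A)%E].
  move=> n; apply: contrapT => noA; apply: noeta.
  exists (1 / (2 ^ n.+1)%:R); first by rewrite divr_gt0// ltr0n expn_gt0.
  move=> A mA Alt; rewrite ltNge; apply/negP => eA; apply: noA.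
  by exists A.
have mF i : measurable (F i) by have [] := PF i.
have mlim : measurable (lim_sup_set F).
  by apply: bigcap_measurable => // k _; exact: bigcup_measurable.
have leb_lim n : (leb (lim_sup_set F) <= (1 / 2 ^+ n)%:E)%E.
  apply: (@le_trans _ _ (leb (\bigcup_k F (k + n)%N))).
    apply: le_lebesgueRd => x /(_ n I)[k /= nk Fkx].
    by exists (k - n)%N => //; rewrite subnK.
  apply: (le_trans
    (lebesgueRd_bigcup _ (fun k => (1 / (2 ^ (k + n.+1))%:R)%:E) _)).
    by move=> k; have [_ + _] := PF (k + n)%N; rewrite addnS.
  by have /cvg_lim -> := @cvg_geometric_eseries_half R 1 n.
have leb0 : leb (lim_sup_set F) = 0%E.
  apply/eqP; rewrite eq_le lebesgueRd_ge0 andbT; apply/lee_addgt0Pr => a a0.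
  rewrite add0e; pose n := (Num.truncn a^-1).+1.
  rewrite (le_trans (leb_lim n))// lee_fin div1r invf_ple ?posrE ?exprn_gt0//.
  rewrite (le_trans (ltW (truncnS_gt _)))// -natrX ler_nat.
  by rewrite ltnW// ltn_expl.
(* Absolute continuity is used in terms of null sets all of whose measurable subsets have value 0;
   monotonicity of the outer measure provides this. *)
have PlimF : P (lim_sup_set F) = 0%E.
  apply: (Pleb (lim_sup_set F)) => // A mA AF; apply/eqP.
  by rewrite eq_le lebesgueRd_ge0 andbT -leb0 le_lebesgueRd.
(* By continuity from above, the lower bound [e] for each [P (F n)] passes to the limsup, a
   contradiction. *)
have eF n : (e%:E <= P (\bigcup_(j >= n) F j))%E.
  have [_ _ /le_trans] := PF n; apply.
  rewrite le_measure// ?inE//; first exact: bigcup_measurable.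
  by apply: bigcup_sup => /=.
suff : (e%:E <= P (lim_sup_set F))%E by rewrite PlimF lee_fin leNgt e0.
have /(_ _ _)/cvg_lim <-// := lim_sup_set_cvg P F.
  apply: lime_ge.
    apply: ereal_nonincreasing_is_cvgn => i j ij.
    rewrite le_measure ?inE//; [exact: bigcup_measurable|
                                exact: bigcup_measurable|].
    by apply: bigcup_subset => n/=; exact: leq_trans.
  by apply: nearW => k; exact: eF.
by rewrite -ge0_fin_numE// fin_num_measure//; exact: bigcup_measurable.
Qed.

End lebesgue_outer.

(** * Brackets *)

Section bracketing.
Context {R : realType} {d : nat}.
Implicit Types (P : probability (borelRd R d) R) (C : set (set 'rV[R]_d)).

Lemma closed_borelRd (A : set (borelRd R d)) :
  closed (A : set 'rV[R]_d) -> measurable A.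
Proof.
move=> clA; rewrite -[A]setCK; apply: measurableC; apply: sub_sigma_algebra.
exact: closed_openC.
Qed.

(* [V j] brackets the complement of [A]: both halves of the bracket are closed
   sets, for which weak convergence yields an upper bound. *)
Definition closed_brackets P C (e : R) (I : finType)
    (V : I -> set 'rV[R]_d) := (forall i, closed (V i)) /\
  forall A, C A -> exists i j,
    [/\ A `<=` V i, ~` A `<=` V j & (P (V i `&` V j) <= e%:E)%E].

Definition closed_bracketing P C := forall e : R, 0 < e ->
  exists (I : finType) (V : I -> set 'rV[R]_d), closed_brackets P C e I V.

(** The complement of the open box of half-side [b], closed so that it can be part of the
    brackets. *)
Definition far (b : nat) : set 'rV[R]_d :=
  \bigcup_(i in [set: 'I_d]) [set x | b%:R <= `|x ord0 i|].

Lemma closed_far b : closed (far b).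
Proof.
apply: closed_bigcup; first exact: finite_finset.
move=> i _; apply: (@preimage_closed _ _ (fun x : 'rV[R]_d => `|x ord0 i|)
    [set y | b%:R <= y]).
  move=> x _; apply: (@continuous_comp _ _ _ (fun y : 'rV[R]_d => y ord0 i)).
    exact: coord_continuous.
  exact: norm_continuous.
exact: closed_ge.
Qed.

Lemma closed_cell b n N (k : {ffun 'I_d -> 'I_N}) :
  closed (cell b n N k : set 'rV[R]_d).
Proof.
have -> : cell b n N k = \bigcap_(i in [set: 'I_d])
    (fun x : 'rV[R]_d => x ord0 i) @^-1`
      `[(k i)%:R / n%:R - b%:R, (k i).+1%:R / n%:R - b%:R]%classic.
  apply/seteqP; split => x kx i; first by move=> _; rewrite /= in_itv/= kx.
  by have := kx i I; rewrite /= in_itv.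
apply: closed_bigI => i _; apply: preimage_closed => [x _|].
  exact: coord_continuous.
exact: itv_closed.
Qed.

Lemma cell_cover b n (x : 'rV[R]_d) : (0 < n)%N -> ~ far b x ->
  exists k : {ffun 'I_d -> 'I_(2 * b * n)}, cell b n _ k x.
Proof.
move=> n0 xb; have nR : 0 < n%:R :> R by rewrite ltr0n.
have /choice[k kP] : forall i, exists k : 'I_(2 * b * n),
    k%:R <= (x ord0 i + b%:R) * n%:R < k.+1%:R.
  move=> i; have : `|x ord0 i| < b%:R.
    by rewrite ltNge; apply/negP => bx; apply: xb; exists i.
  rewrite ltr_norml => /andP[xb0 xb1].
  have xn : 0 <= (x ord0 i + b%:R) * n%:R by rewrite mulr_ge0//; lra.
  have /andP[t0 t1] := truncn_itv xn.
  have tN : (Num.truncn ((x ord0 i + b%:R) * n%:R) < 2 * b * n)%N.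
    rewrite -(ltr_nat R) (le_lt_trans t0)// !natrM ltr_pM2r//; lra.
  by exists (Ordinal tN); rewrite t0 t1.
exists (finfun k) => i; have /andP[k0 /ltW k1] := kP i; rewrite ffunE.
by rewrite lerBlDr lerBrDr ler_pdivrMr// ler_pdivlMr// k0 k1.
Qed.

Lemma far_cvg0 P (e : R) : 0 < e -> exists b, (P (far b) < e%:E)%E.
Proof.
move=> e0.
have mfar b : measurable (far b : set (borelRd R d)).
  by apply: closed_borelRd; exact: closed_far.
have far0 : \bigcap_b far b = set0.
  apply/seteqP; split => // x farx.
  have [i _ /=] := farx (Num.truncn (enorm x)).+1 I.
  by rewrite leNgt (le_lt_trans (coord_le_enorm _ _))// truncnS_gt.
have : P \o far @ \oo --> P (\bigcap_b far b).
  apply: nonincreasing_cvg_mu => //.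
  - by rewrite -ge0_fin_numE// fin_num_measure.
  - by rewrite far0.
  - move=> b c bc; apply/subsetPset => x [i _ /= xi]; exists i => //=.
    by rewrite (le_trans _ xi)// ler_nat.
rewrite far0 measure0 => /fine_cvgP[_ /cvgr_lt/(_ e)] /= /(_ e0) [b _ /(_ b)].
move=> /(_ (leqnn b)) Pb; exists b.
by rewrite -(@fineK _ (P (far b))) ?fin_num_measure// lte_fin.
Qed.

Lemma cone_separated_bracketing P C (r K : R) : (0 < d)%N -> 0 < r ->
  P `<< @lebesgueRd R d -> C `<=` cone_separated r K ->
  closed_bracketing P C.
Proof.
move=> d0 r0 Pleb Csep e e0.
have [b Pb] := far_cvg0 P (e / 2) (divr_gt0 e0 (ltr0Sn _ 1)).
have [eta eta0 etaP] :=
  lebesgueRd_dominates P Pleb _ (divr_gt0 e0 (ltr0Sn _ 1)).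
pose L := (Num.truncn (2 / r)).+1.
have Lr : 2 < L%:R * r by rewrite -ltr_pdivrMr// truncnS_gt.
pose W := (Num.truncn (L%:R * K)).+1.
have LKW : L%:R * K <= W%:R by rewrite ltW// truncnS_gt.
(* With boxes of side [2 / n], the count of straddling cells bounds their outer measure by
   [c / m.+1], which the choice of [m] puts below [eta]. The factor 2 in [c] is that of the side;
   [n] is then chosen to satisfy [m L <= n]. *)
pose c := ((2 * W).+1 ^ d * (2 * (2 * b + 2 * W + 1)) ^ d)%N.
pose m := Num.truncn (c%:R / eta).
have mc : c%:R < m.+1%:R * eta by rewrite -ltr_pdivrMr// truncnS_gt.
pose n := (m.+1 * L)%N.
have n0 : (0 < n)%N by rewrite muln_gt0.
have nR : 0 < n%:R :> R by rewrite ltr0n.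
have mLn : (m * L <= n)%N by rewrite leq_mul2r leqnSn orbT.
pose N := (2 * b * n)%N.
pose G (A : set 'rV[R]_d) := straddling b n N A.
have PG A : C A ->
    (P (\bigcup_(k in [set k | k \in G A]) cell b n N k) < (e / 2)%:E)%E.
  move=> /Csep sepA; apply: etaP.
    apply: closed_borelRd; apply: closed_bigcup; first exact: finite_finset.
    by move=> k _; exact: closed_cell.
  (* Cells are closed and boxes half-open, so the lower corner is moved down by [1 / n], which
     doubles the side. *)
  pose lo (k : {ffun 'I_d -> 'I_N}) : 'rV[R]_d :=
    \row_i ((k i)%:R / n%:R - b%:R - n%:R^-1).
  pose hi (k : {ffun 'I_d -> 'I_N}) : 'rV[R]_d :=
    \row_i ((k i).+1%:R / n%:R - b%:R).
  apply: (@le_lt_trans _ _ (#|G A|%:R * (2 / n%:R) ^+ d)%:E).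
    apply: (le_trans _ (lebesgueRd_le_card _ (G A) lo hi (2 / n%:R) d0 _ _)).
    - apply: le_lebesgueRd => x [k kG kx]; exists k => // i; rewrite !mxE.
      have /andP[k0 ->] := kx i; rewrite andbT (lt_le_trans _ k0)//.
      by rewrite ltrBlDr ltrDl invr_gt0.
    - by rewrite divr_ge0.
    - move=> k i; rewrite !mxE -natr1 !mulrDl; ring.
  rewrite lte_fin -(@ltr_pM2l _ m.+1%:R)// (le_lt_trans _ mc)//.
  have := card_straddling r K b n N m W L A sepA Lr LKW n0 mLn.
  rewrite -/(G A) => cardG.
  have mn : (m <= n)%N by rewrite /n mulnS; lia.
  have Nn : ((N + 2 * (m * W)).+1 <= n * (2 * b + 2 * W + 1))%N.
    by rewrite /N; nia.
  have {}cardG : (#|G A| * m.+1 * 2 ^ d <= c * n ^ d)%N.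
    rewrite /c (expnMn 2) (mulnC (2 ^ d)%N) -!mulnA (mulnC (2 ^ d)%N).
    rewrite [leqRHS]mulnA [leqRHS](_ : _ =
      (2 * W).+1 ^ d * (n * (2 * b + 2 * W + 1)) ^ d * 2 ^ d)%N; last first.
      by rewrite expnMn; ring.
    rewrite mulnA leq_mul2r (leq_trans cardG) ?orbT// leq_mul2l.
    by rewrite leq_exp2r// Nn orbT.
  rewrite mulrA expr_div_n mulrA ler_pdivrMr ?exprn_gt0// -!natrX -!natrM.
  by rewrite ler_nat (mulnC m.+1).
exists {set {ffun 'I_d -> 'I_N}}.
exists (fun J : {set {ffun 'I_d -> 'I_N}} =>
  far b `|` \bigcup_(k in [set k | k \in J]) cell b n N k); split.
  move=> J; apply: closedU; first exact: closed_far.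
  apply: closed_bigcup; first exact: finite_finset.
  by move=> k _; exact: closed_cell.
move=> A CA; pose meets (B : set 'rV[R]_d) : {set {ffun 'I_d -> 'I_N}} :=
  [set k : {ffun 'I_d -> 'I_N} | `[< cell b n N k `&` B !=set0 >]]%SET.
have cover B : B `<=` far b `|`
    \bigcup_(k in [set k | k \in meets B]) cell b n N k.
  move=> x Bx; have [|/(cell_cover _ _ _ n0)[k kx]] := pselect (far b x).
    by left.
  by right; exists k => //=; rewrite inE; apply/asboolP; exists x.
exists (meets A), (meets (~` A)); split => //.
rewrite -setUIr (splitr e) EFinD.
have mfar : measurable (far b : set (borelRd R d)).
  by apply: closed_borelRd; exact: closed_far.
have mcells (J : {set {ffun 'I_d -> 'I_N}}) : measurable
    (\bigcup_(k in [set k | k \in J]) cell b n N k : set (borelRd R d)).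
  apply: closed_borelRd; apply: closed_bigcup; first exact: finite_finset.
  by move=> k _; exact: closed_cell.
apply: (le_trans (measureU2 _ mfar (measurableI _ _ (mcells _) (mcells _)))).
apply: leeD; first exact: ltW.
apply: le_trans (ltW (PG A CA)).
apply: le_measure; rewrite ?inE//; first exact: measurableI.
move=> x [[k /= + kx] [k' /= + k'x]]; rewrite !inE => kA k'A.
(* Closed cells may share [x] on their faces, so [k] and [k'] can differ. Whichever side [x] is on,
   it supplies the missing point to one of them, which is then straddling. *)
have [Ax|nAx] := pselect (A x).
  by exists k' => //=; rewrite inE; apply/asboolP; split;
    [exists x|exact: k'A].
by exists k => //=; rewrite inE; apply/asboolP; split; [exact: kA|exists x].
Qed.

End bracketing.

(** * Weak convergence *)

Section deviation.
Context {R : realType} {d : nat}.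
Implicit Types (P : probability (borelRd R d) R) (C : set (set 'rV[R]_d)).

Lemma continuous_borelRd (f : 'rV[R]_d -> R) : continuous f ->
  measurable_fun setT (f : borelRd R d -> R).
Proof.
move=> /continuousP cf; apply: (measurability _ (RGenOpens.measurableE R)).
move=> _ [_ [a [b ->] <-]]; rewrite setTI; apply: sub_sigma_algebra.
exact/cf/interval_open.
Qed.

(** The open neighbourhoods of [V] of radius [1 / k.+1] decrease to [V], so continuity from above
    applies. *)
Lemma closed_outer_approx P (V : set 'rV[R]_d) (e : R) : closed V -> 0 < e ->
  exists U : set 'rV[R]_d,
    [/\ open U, V `<=` U & (P U < P V + e%:E)%E].
Proof.
move=> clV e0; pose O (k : nat) : set 'rV[R]_d :=
  \bigcup_(y in V) ball y (k.+1%:R^-1 : R).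
have oO k : open (O k) by apply: bigcup_open => y _; exact: ball_open.
have mO k : measurable (O k : set (borelRd R d)) by exact: sub_sigma_algebra.
have VO k : V `<=` O k by move=> y Vy; exists y => //; exact: ballxx.
have capO : \bigcap_k O k = V.
  apply/seteqP; split => [x Ox|x Vx k _]; last exact: VO.
  apply: clV => B /nbhs_ballP[a /= a0 aB].
  have [y Vy xy] := Ox (Num.truncn a^-1) I.
  exists y; split => //; apply: aB; apply: ball_sym; apply: le_ball xy.
  by rewrite invf_ple ?posrE// ltW// truncnS_gt.
have mV : measurable (V : set (borelRd R d)) by exact: closed_borelRd.
have : P \o O @ \oo --> P (\bigcap_b O b).
  apply: nonincreasing_cvg_mu => //.
  - by rewrite -ge0_fin_numE// fin_num_measure.
  - by rewrite capO.
  - move=> j k jk; apply/subsetPset => x [y Vy xy]; exists y => //.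
    by apply: le_ball xy; rewrite lef_pV2 ?posrE// ler_nat.
rewrite capO -(@fineK _ (P V)) ?fin_num_measure//.
move=> /fine_cvgP[_ /cvgr_lt/(_ (fine (P V) + e))] /=.
rewrite ltrDl => /(_ e0)[k _ /(_ k (leqnn k))] Pk; exists (O k); split => //.
by rewrite -(@fineK _ (P (O k))) ?fin_num_measure// -EFinD lte_fin.
Qed.

(** Part of the portmanteau theorem: a Urysohn function [f] lies between the indicators of [V] and
    of a slightly larger open [U], so [Pn n V] is at most its integral, which tends to one bounded
    by [P U]. *)
Lemma weakly_converges_closed (Pn : nat -> probability (borelRd R d) R) P
    (V : set 'rV[R]_d) (e : R) : weakly_converges Pn P -> closed V -> 0 < e ->
  \forall n \near \oo, (Pn n V <= P V + e%:E)%E.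
Proof.
move=> PnP clV e0; have [U [oU VU PU]] := closed_outer_approx P V e clV e0.
pose f : 'rV[R]_d -> R := Urysohn (~` U) V.
have sepUV : uniform_separator (~` U) V.
  apply: (iffLR (@normal_separatorP R _)) => //.
  - exact: pseudometric_normal.
  - exact: open_closedC.
  - by rewrite -subset0 => x [] /= nUx /VU.
have cf : continuous f by exact: Urysohn_continuous.
have f01 x : 0 <= f x <= 1.
  have := @Urysohn_range _ R (~` U) V (f x) (ex_intro2 _ _ x I erefl).
  by rewrite /= in_itv.
have mf : measurable_fun setT (EFin \o f : borelRd R d -> \bar R).
  by apply/measurable_EFinP; exact: continuous_borelRd.
have mV : measurable (V : set (borelRd R d)) by exact: closed_borelRd.
have mU : measurable (U : set (borelRd R d)) by exact: sub_sigma_algebra.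
have Vf (Q : probability (borelRd R d) R) : (Q V <= \int[Q]_x (f x)%:E)%E.
  rewrite -[V in leLHS]setIT -integral_indic//; apply: ge0_le_integral => //.
  - by apply/measurable_EFinP; exact: measurable_indic.
  move=> x _; rewrite lee_fin indicE; have [Vx|nVx] := pselect (V x).
    rewrite mem_set//; have -> // : f x = 1.
    by apply: (@Urysohn_sub1 _ R _ _ sepUV); exists x.
  by rewrite memNset//; have /andP[] := f01 x.
have fU : (\int[P]_x (f x)%:E <= P U)%E.
  rewrite -[U in leRHS]setIT -integral_indic//; apply: ge0_le_integral => //.
  - by move=> x _; rewrite lee_fin; have /andP[] := f01 x.
  - by apply/measurable_EFinP; exact: measurable_indic.
  move=> x _; rewrite lee_fin indicE; have [Ux|nUx] := pselect (U x).
    by rewrite mem_set//; have /andP[] := f01 x.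
  rewrite memNset//; have -> // : f x = 0.
  by apply: (@Urysohn_sub0 _ R _ _ sepUV); exists x.
have fbd : bounded_fun f.
  exists 1; split => // M M1 x _; rewrite /= ger0_norm.
    by have /andP[_ /le_trans] := f01 x; apply; exact: ltW.
  by have /andP[] := f01 x.
have := PnP f cf fbd.
have ffin : (\int[P]_x (f x)%:E)%E \is a fin_num.
  rewrite ge0_fin_numE.
    by rewrite (le_lt_trans fU)// -ge0_fin_numE// fin_num_measure.
  by apply: integral_ge0 => x _; rewrite lee_fin; have /andP[] := f01 x.
rewrite -(fineK ffin) => /fine_cvgP[fin_n /cvgr_lt/(_ (fine (P V) + e))].
have -> : fine (\int[P]_x (f x)%:E)%E < fine (P V) + e.
  rewrite -lte_fin fineK// EFinD fineK ?fin_num_measure//.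
  exact: le_lt_trans PU.
move=> /(_ isT) lt_n; near=> n.
rewrite (le_trans (Vf (Pn n)))// -(@fineK _ (P V)) ?fin_num_measure//.
rewrite -[leLHS]fineK; last by near: n; exact: fin_n.
by rewrite -EFinD lee_fin ltW//; near: n; exact: lt_n.
Unshelve. all: by end_near. Qed.

(** Common to both modes of convergence. Upper bounds on the two closed halves suffice: the one
    containing [A] bounds its deviation from above, the one containing the complement bounds it from
    below. Restricting to [0 < n] leaves out the junk value of [empirical]. *)
Lemma bracketing_sup_deviation P C (m : nat -> set (borelRd R d) -> \bar R) :
  C !=set0 -> (forall A : set (borelRd R d), C A -> measurable A) ->
  (forall n, (0 < n)%N -> exists Q : probability (borelRd R d) R, m n = Q) ->
  (forall e : R, 0 < e -> exists (I : finType) (V : I -> set 'rV[R]_d),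
    closed_brackets P C e I V /\
    forall i, \forall n \near \oo, (m n (V i) <= P (V i) + e%:E)%E) ->
  sup_deviation C (m n) P @[n --> \oo] --> 0%E.
Proof.
move=> [A0 CA0] mC mP brC.
have dev0 n : (0 <= sup_deviation C (m n) P)%E.
  apply: (@le_trans _ _ `|m n A0 - P A0|%E) => //.
  by apply: ereal_sup_ubound; exists A0.
suff devP (e : R) : 0 < e ->
    \forall n \near \oo, (sup_deviation C (m n) P <= e%:E)%E.
  apply/fine_cvgP; split.
    near=> n; rewrite ge0_fin_numE//.
    rewrite (@le_lt_trans _ _ 1%E) ?ltry//.
    by near: n; exact: devP.
  apply/cvgrPdist_le => e e0; near=> n.
  have dev_e : (sup_deviation C (m n) P <= e%:E)%E by near: n; exact: devP.
  rewrite sub0r normrN ger0_norm; last exact: fine_ge0.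
  by rewrite -lee_fin fineK// ge0_fin_numE// (le_lt_trans dev_e) ?ltry.
move=> e0; have e20 : 0 < e / 2 by rewrite divr_gt0.
have [I [V [[clV brV] mclosed]]] := brC _ e20.
have mV : \forall n \near \oo, forall i, (m n (V i) <= P (V i) + (e / 2)%:E)%E.
  by apply: filter_forall => i; exact: mclosed.
near=> n.
have n0 : (0 < n)%N by near: n; exists 1%N.
have [Q mQ] := mP n n0.
have QV : forall i, (Q (V i) <= P (V i) + (e / 2)%:E)%E.
  by rewrite -mQ; near: n; exact: mV.
apply/ereal_supP => _ [A CA <-]; rewrite mQ.
have [i [j [AVi AVj PV]]] := brV A CA.
have mA : measurable (A : set (borelRd R d)) by exact: mC.
have mVk k : measurable (V k : set (borelRd R d)) by exact: closed_borelRd.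
have fin (S : probability (borelRd R d) R) B : measurable B ->
  S B = (fine (S B))%:E by move=> mB; rewrite fineK// fin_num_measure.
have mono (S : probability (borelRd R d) R) (B : set (borelRd R d)) k :
    measurable B -> B `<=` V k ->
    fine (S B) <= fine (S (V k)).
  by move=> mB BV; rewrite -lee_fin -!fin// le_measure ?inE.
have compl (S : probability (borelRd R d) R) :
    fine (S (~` A)) = 1 - fine (S A).
  apply: EFin_inj; rewrite EFinB -!fin ?probability_setC//.
  exact: measurableC.
(* [V i] is split along [V j]: the part outside adds up with [V j] to at most 1, and the part inside
   is the small overlap. *)
have PVV : fine (P (V i)) + fine (P (V j)) <= 1 + e / 2.
  rewrite -lee_fin !EFinD -!fin//.
  rewrite (measureDI _ (mVk i) (mVk j)) addeAC.
  rewrite leeD// -(@probability_setT _ _ _ P) -(setvU (V j)) measureU//.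
  - by rewrite leeD2r// le_measure ?inE//;
      [exact: measurableD|exact: measurableC].
  - exact: measurableC.
  - exact: setICl.
have mV' k : fine (Q (V k)) <= fine (P (V k)) + e / 2.
  by rewrite -lee_fin EFinD -!fin//; exact: QV.
have mAc := measurableC mA.
rewrite (fin Q A)// (fin P A)// -EFinB lee_fin ler_norml.
have := compl Q; have := compl P.
have := mono Q _ _ mA AVi; have := mono Q _ _ mAc AVj.
have := mono P _ _ mA AVi; have := mono P _ _ mAc AVj.
by have := mV' i; have := mV' j; move=> *; apply/andP; split; lra.
Unshelve. all: by end_near. Qed.

Lemma bracketing_uniformity P C :
  C !=set0 -> (forall A : set (borelRd R d), C A -> measurable A) ->
  closed_bracketing P C -> uniformity_class P C.
Proof.
move=> C0 mC brC; split => // Pn PnP; apply: bracketing_sup_deviation => //.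
  by move=> n _; exists (Pn n).
move=> e e0; have [I [V [clV brV]]] := brC e e0; exists I, V; split => // i.
exact: weakly_converges_closed.
Qed.

End deviation.

(** * Strong law of large numbers for indicators *)

Lemma sqrt_floor (n : nat) : exists k, (k ^ 2 <= n < k.+1 ^ 2)%N.
Proof.
elim: n => [|n [k /andP[kn nk]]]; first by exists 0%N.
have [nk'|nk'] := ltnP n.+1 (k.+1 ^ 2).
  by exists k; rewrite nk' (leq_trans kn).
exists k.+1; rewrite nk' (leq_ltn_trans nk)// ltn_sqr; exact: ltnSn.
Qed.

(** From [k ^ 2] to [n < k.+1 ^ 2] the value of [T] grows by at most [2 k], which is below [e k ^ 2]
    once [k] exceeds [2 / e]. *)
Lemma bound_along_squares {R : realType} (T : nat -> R) (c e : R) :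
  (forall n, T n.+1 <= T n + 1) -> 0 <= c -> 0 < e ->
  (\forall k \near \oo, T (k ^ 2)%N <= c * (k ^ 2)%:R) ->
  \forall n \near \oo, T n <= (c + e) * n%:R.
Proof.
move=> TS c0 e0 [K _ KT]; pose M := maxn K (Num.truncn (2 / e)).+1.
exists (M ^ 2)%N => // n /= Mn; have [k /andP[kn nk]] := sqrt_floor n.
have Mk : (M <= k)%N.
  by rewrite -ltnS -ltn_sqr (leq_ltn_trans Mn).
have Tk : T (k ^ 2)%N <= c * (k ^ 2)%:R.
  by apply: KT; rewrite /= (leq_trans _ Mk)// leq_maxl.
have Tadd j : T (k ^ 2 + j)%N <= T (k ^ 2)%N + j%:R.
  elim: j => [|j IHj]; first by rewrite addn0 addr0.
  by rewrite addnS (le_trans (TS _))// -natr1 addrA lerD2r.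
have := Tadd (n - k ^ 2)%N; rewrite subnKC// => Tn.
have nk2 : (n - k ^ 2)%:R <= 2 * k%:R :> R.
  by rewrite -natrM ler_nat leq_subLR; move: nk; rewrite !expnS !expn0; lia.
have ek : 2 * k%:R <= e * (k ^ 2)%:R.
  rewrite natrX expr2 mulrA ler_wpM2r// -ler_pdivrMl// mulrC ltW//.
  rewrite (lt_le_trans (truncnS_gt _))// ler_nat (leq_trans _ Mk)//.
  exact: leq_maxr.
have : c * (k ^ 2)%:R <= c * n%:R by rewrite ler_wpM2l// ler_nat.
have : e * (k ^ 2)%:R <= e * n%:R by rewrite ler_pM2l// ler_nat.
by rewrite mulrDl; lra.
Qed.

Lemma sum_inv_squares_lty {R : realType} (c : R) : 0 <= c ->
  (\sum_(k <oo) (c / (k.+1 ^ 2)%:R)%:E < +oo)%E.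
Proof.
move=> c0.
(* The telescoping bound of 1 / (x + 1)^2 by 1 / x - 1 / (x + 1). *)
have part n : \sum_(0 <= k < n.+1) c / (k.+1 ^ 2)%:R <= c * (2 - n.+1%:R^-1).
  elim: n => [|n IHn].
    by rewrite big_nat1 invr1 ler_wpM2l//; lra.
  rewrite big_nat_recr//= (le_trans (lerD IHn (lexx _)))// -mulrDr ler_wpM2l//.
  have x0 : 0 < n.+1%:R :> R by [].
  rewrite natrX -[n.+2%:R]natr1; move: (n.+1%:R : R) x0 => x x0.
  suff : 0 <= x^-1 - (x + 1)^-1 - ((x + 1) ^+ 2)^-1 by lra.
  rewrite (_ : _ - _ = ((x + 1) ^+ 2 * x)^-1).
    by rewrite invr_ge0 mulr_ge0 ?sqr_ge0// ltW.
  by field; rewrite !gt_eqF// addr_gt0.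
apply: (@le_lt_trans _ _ (c * 2)%:E); last exact: ltry.
apply: lime_le.
  by apply: is_cvg_nneseries => k _ _; rewrite lee_fin divr_ge0.
exists 1%N => // -[//|n] _; rewrite sumEFin lee_fin (le_trans (part n))//.
by rewrite ler_wpM2l// lerBlDr lerDl invr_ge0.
Qed.

Section law_of_large_numbers.
Context {R : realType} {dO : measure_display} {Omega : measurableType dO}.
Variables (Q : probability Omega R) (E : nat -> set Omega) (p : R).
Hypotheses (mE : forall i, measurable (E i)) (QE : forall i, Q (E i) = p%:E).
Hypothesis QEE : forall i j, i != j -> Q (E i `&` E j) = (p ^+ 2)%:E.

Let count (n : nat) : Omega -> R := \sum_(i < n) \1_(E i).

Lemma Lfun2_indic (A : set Omega) : measurable A -> \1_A \in Lfun Q 2%:E.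
Proof.
move=> mA; rewrite inE/=; apply/andP; split; rewrite inE/=.
  exact: measurable_indic.
rewrite /finite_norm unlock poweR_lty//.
under eq_integral => x _/=.
  rewrite (_ : `|\1_A x| `^ 2 = \1_A x); last first.
    by rewrite indicE; case: (x \in A); rewrite ?normr1 ?normr0 ?powR1 ?powR0.
  over.
by rewrite integral_indic// setIT -ge0_fin_numE// fin_num_measure.
Qed.

Let count_Lfun2 n : count n \in Lfun Q 2%:E.
Proof. by apply: rpred_sum => [|? i _]; [rewrite lee1n|exact: Lfun2_indic]. Qed.

Let subset12 : {subset Lfun Q 2%:E <= Lfun Q 1}.
Proof. by apply: Lfun_subset12; rewrite fin_num_measure. Qed.

Let countS n : count n.+1 = count n \+ \1_(E n).
Proof. by rewrite /count big_ord_recr. Qed.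

Let count_expectation n : ('E_Q[count n] = (n%:R * p)%:E)%E.
Proof.
elim: n => [|n IHn]; first by rewrite /count big_ord0 mul0r expectation_cst.
rewrite countS expectationD ?subset12 ?Lfun2_indic//.
by rewrite IHn expectation_indic// QE -EFinD -natr1 mulrDl mul1r.
Qed.

Let covariance_indic i j : i != j -> (covariance Q \1_(E i) \1_(E j) = 0)%E.
Proof.
move=> ij; rewrite covarianceE ?Lfun2_mul_Lfun1 ?subset12 ?Lfun2_indic//.
have -> : (\1_(E i) * \1_(E j) : Omega -> R) = \1_(E i `&` E j).
  by rewrite indicI.
rewrite !expectation_indic//; last exact: measurableI.
by rewrite QEE// !QE -EFinM -EFinB expr2 subrr.
Qed.

Let covariance_count n j : (n <= j)%N ->
  (covariance Q (count n) \1_(E j) = 0)%E.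
Proof.
elim: n => [|n IHn] nj; first by rewrite /count big_ord0 covariance_cst_l.
rewrite countS covarianceDl ?Lfun2_indic// IHn ?(ltnW nj)//.
rewrite covariance_indic ?adde0//.
by rewrite ltn_eqF.
Qed.

(** The indicators are uncorrelated by pairwise independence, so variances add up; each is p - p^2,
    at most 1. *)
Let variance_count n : ('V_Q[count n] <= n%:R%:E)%E.
Proof.
elim: n => [|n IHn]; first by rewrite /count big_ord0 variance_cst.
rewrite countS varianceD ?Lfun2_indic// covariance_count// mule0 adde0.
rewrite -natr1 EFinD leeD// varianceE ?Lfun2_indic//.
have -> : (\1_(E n) ^+ 2 : Omega -> R) = \1_(E n).
  by rewrite expr2 -[in RHS](setIid (E n)) indicI.
rewrite expectation_indic// QE -EFin_expe -EFinB lee_fin.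
have : p <= 1 by rewrite -lee_fin -(QE 0) probability_le1.
by have := sqr_ge0 p; lra.
Qed.

Let p_ge0 : 0 <= p.
Proof. by rewrite -lee_fin -(QE 0). Qed.

Let count_mfun n : count n \in mfun.
Proof. by have := count_Lfun2 n; rewrite inE => /andP[]. Qed.

Let exceed (e : R) (k : nat) : set Omega :=
  [set w | e * (k.+1 ^ 2)%:R <= `|count (k.+1 ^ 2) w - (k.+1 ^ 2)%:R * p|].

Let exceed_measurable e k : measurable (exceed e k).
Proof.
rewrite -[exceed e k]setTI.
apply: (@measurable_fun_le _ _ _ _ (cst _) (fun w => `|count _ w - _|)) => //.
apply: measurableT_comp => //; apply: measurable_funB => //.
by have := count_mfun (k.+1 ^ 2); rewrite inE.
Qed.

(** Chebyshev with variance at most [n] gives [n / (e n)^2], summable along the squares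
    [n = k.+1 ^ 2]. *)
Let exceed_le e k : 0 < e -> (Q (exceed e k) <= (e ^- 2 / (k.+1 ^ 2)%:R)%:E)%E.
Proof.
move=> e0; pose n := (k.+1 ^ 2)%N.
have n0 : 0 < n%:R :> R by rewrite ltr0n expn_gt0.
pose X : {RV Q >-> R} := mfun_Sub (count_mfun n).
have /(chebyshev X) : 0 < e * n%:R by rewrite mulr_gt0.
rewrite (count_expectation n : ('E_Q[X] = _)%E)/= => /le_trans; apply.
apply: (@le_trans _ _ ((e * n%:R) ^- 2 * n%:R)%:E).
  by rewrite EFinM lee_wpmul2l ?lee_fin ?invr_ge0 ?sqr_ge0//;
    exact: variance_count.
rewrite lee_fin -/n exprMn invfM -mulrA ler_wpM2l ?invr_ge0 ?sqr_ge0//.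
by rewrite expr2 invfM -mulrA mulVf ?mulr1// gt_eqF.
Qed.

(** Borel-Cantelli for each of the countably many tolerances [1 / m.+1] gives one null set valid for
    all [e]; the gaps between squares are filled by [bound_along_squares]. *)
Lemma count_eventually_le : {ae Q, forall w, forall e : R, 0 < e ->
  \forall n \near \oo, \sum_(i < n) \1_(E i) w <= (p + e) * n%:R}.
Proof.
pose e m : R := m.+1%:R^-1.
have e0 m : 0 < e m by rewrite invr_gt0.
have : {ae Q, forall w, forall m, ~ lim_sup_set (exceed (e m)) w}.
  apply: ae_foralln => m; exists (lim_sup_set (exceed (e m))); split.
  - by apply: bigcap_measurable => // k _; exact: bigcup_measurable.
  - apply: lim_sup_set_cvg0 => //.
    apply: le_lt_trans (sum_inv_squares_lty (e m ^- 2) _).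
      by apply: lee_nneseries => // k _; exact: exceed_le.
    by rewrite invr_ge0 sqr_ge0.
  - by move=> w /= /contrapT.
apply: filterS => w nF a a0.
pose m := Num.truncn (2 / a).
(* Half of [a] is for the deviation along the squares, half for the gaps between them. *)
have ema : e m < a / 2.
  by rewrite invf_plt ?posrE ?divr_gt0// invf_div truncnS_gt.
have countE n : count n w = \sum_(i < n) \1_(E i) w.
  by rewrite /count fct_sumE.
have : \forall n \near \oo, count n w <= (p + e m + a / 2) * n%:R.
  apply: bound_along_squares; last 3 first.
  - by rewrite addr_ge0// ltW.
  - by rewrite divr_gt0.
  - have [K nK] : exists K, ~ (\bigcup_(j >= K) exceed (e m) j) w.
      apply: contrapT => nK; apply: (nF m) => K _.
      by apply: contrapT => nKw; apply: nK; exists K.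
    exists K.+1 => // -[//|k] /= Kk.
    have : ~ exceed (e m) k w by move=> kw; apply: nK; exists k.
    rewrite /exceed/= => /negP; rewrite -ltNge ltr_norml => /andP[_].
    by rewrite ltrBlDr => /ltW; rewrite mulrDl addrC (mulrC p).
  by move=> n; rewrite countS lerD2l indicE lern1 leq_b1.
apply: filterS => n; rewrite countE => /le_trans; apply.
by rewrite ler_wpM2r//; lra.
Qed.

End law_of_large_numbers.

(** * Empirical measures *)

Section glivenko_cantelli.
Context {R : realType} {d : nat}.
Implicit Types (P : probability (borelRd R d) R) (C : set (set 'rV[R]_d)).

Lemma empirical_probability (x : nat -> borelRd R d) (n : nat) : (0 < n)%N ->
  exists Q : probability (borelRd R d) R, @empirical R d x n = Q.
Proof.
move=> n0; pose mu : {measure set (borelRd R d) -> \bar R} :=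
  msum (fun i => @dirac _ (borelRd R d) (x i) R) n.
have muT : (mu setT = n%:R%:E)%E.
  rewrite /= /msum (eq_bigr (fun=> 1%E)) ?sumEFin ?sumr_const ?card_ord//.
  by move=> i _; exact: diracT.
(* The default that [mnormalize] takes for a total mass zero or infinite; here the mass is
   [n > 0]. *)
pose D : probability (borelRd R d) R := @dirac _ (borelRd R d) (x 0%N) R.
have muE A : mnormalize mu D A = (mu A * (n%:R^-1)%:E)%E.
  by rewrite /mnormalize muT gt_eqF ?lte_fin ?ltr0n.
exists (mnormalize mu D); apply/funext => A.
by rewrite -[RHS]/(mnormalize mu D A) muE muleC.
Qed.

Lemma iid_pair (dO : measure_display) (Omega : measurableType dO)
    (Q : probability Omega R) (X : nat -> {RV Q >-> borelRd R d}) P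
    (V : set (borelRd R d)) i j : iid_with_law X P -> measurable V -> i != j ->
  Q (X i @^-1` V `&` X j @^-1` V) = (P V * P V)%E.
Proof.
move=> [indep law] mV ij.
have := indep (i |` [fset j])%fset (fun=> V) (fun=> mV).
have PX k : Q (X k @^-1` V) = P V := law k V mV.
rewrite big_fsetU1 ?inE//= big_seq_fset1 !PX => <-; congr (Q _).
apply/seteqP; split=> [w [wi wj] k /=|w wV].
  by rewrite !inE => /orP[]/eqP ->.
by split; apply: wV; rewrite /= !inE eqxx ?orbT.
Qed.

Lemma empirical_eventually_le (dO : measure_display) (Omega : measurableType dO)
    (Q : probability Omega R) (X : nat -> {RV Q >-> borelRd R d}) P
    (V : set (borelRd R d)) : iid_with_law X P -> measurable V ->
  {ae Q, forall w, forall e : R, 0 < e ->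
    \forall n \near \oo, (empirical (fun i => X i w) n V <= P V + e%:E)%E}.
Proof.
move=> iidX mV; have PV : P V = (fine (P V))%:E.
  by rewrite fineK// fin_num_measure.
have mE i : measurable (X i @^-1` V).
  by rewrite -[X in measurable X]setTI; exact: measurable_funP.
have QE i : Q (X i @^-1` V) = (fine (P V))%:E.
  by rewrite -PV -(iidX.2 i V mV).
have QEE i j : i != j ->
    Q (X i @^-1` V `&` X j @^-1` V) = (fine (P V) ^+ 2)%:E.
  by move=> ij; rewrite (iid_pair _ _ _ _ P)// PV -EFinM expr2.
have := count_eventually_le Q (fun i => X i @^-1` V) _ mE QE QEE.
apply: filterS => w count_le e e0; near=> n.
have n0 : (0 < n)%N by near: n; exists 1%N.
rewrite /empirical PV -EFinD sumEFin -EFinM lee_fin.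
rewrite ler_pdivrMl ?ltr0n// mulrC.
have : \sum_(i < n) \1_(X i @^-1` V) w <= (fine (P V) + e) * n%:R.
  by near: n; exact: count_le.
by [].
Unshelve. all: by end_near. Qed.

(** Brackets of precision [1 / m.+1] involve countably many closed sets in all, so a single null set
    serves every precision. *)
Lemma bracketing_glivenko_cantelli P C :
  C !=set0 -> (forall A : set (borelRd R d), C A -> measurable A) ->
  closed_bracketing P C -> glivenko_cantelli_class P C.
Proof.
move=> C0 mC brC; split => // dO Omega Q X iidX.
have /choice[B brB] : forall m : nat,
    exists B : {I : finType & I -> set 'rV[R]_d},
      closed_brackets P C m.+1%:R^-1 (projT1 B) (projT2 B).
  move=> m; have [//|I [V brV]] := brC m.+1%:R^-1.
  by exists (existT _ I V).
have : {ae Q, forall w, forall (m : nat) (i : projT1 (B m)) (e : R), 0 < e ->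
    \forall n \near \oo, (empirical (fun j => X j w) n (projT2 (B m) i) <=
      P (projT2 (B m) i) + e%:E)%E}.
  apply: ae_foralln => m; apply: filter_forall => i.
  apply: empirical_eventually_le => //; apply: closed_borelRd.
  by have [] := brB m.
apply: filterS => w wB; apply: bracketing_sup_deviation => //.
  by move=> n n0; exact: empirical_probability.
move=> e e0; pose m := Num.truncn e^-1.
exists (projT1 (B m)), (projT2 (B m)); split => [|i]; last exact: wB.
have [clB brm] := brB m; split => // A /brm[i [j [Ai Aj PB]]].
exists i, j; split => //; rewrite (le_trans PB)// lee_fin.
by rewrite invf_ple ?posrE// ltW// truncnS_gt.
Qed.

End glivenko_cantelli.

Theorem theorem3 (R : realType) (d : nat) (rho h : R)
    (P : probability (borelRd R d) R) :
  (0 < d)%N -> 0 < rho < pi -> 0 < h -> P `<< @lebesgueRd R d ->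
  (uniformity_class P (@cone_class R d rho h) /\
   glivenko_cantelli_class P (@cone_class R d rho h)) /\
  (uniformity_class P (@cone_hull_class R d rho h) /\
   glivenko_cantelli_class P (@cone_hull_class R d rho h)).
Proof.
move=> d0 rhopi h0 Pleb.
(* The whole space belongs to both classes and witnesses that they are nonempty. *)
have class_ok (C : set (set 'rV[R]_d)) : C setT ->
    (forall S, C S -> closed S) ->
    C `<=` cone_separated (probe_radius (d := d) rho h) (2 * h) ->
    uniformity_class P C /\ glivenko_cantelli_class P C.
  move=> CT Ccl Csep.
  have C0 : C !=set0 by exists setT.
  have mC (A : set (borelRd R d)) : C A -> measurable A.
    by move=> /Ccl; exact: closed_borelRd.
  have brC : closed_bracketing P C.
    by apply: cone_separated_bracketing Csep => //; exact: probe_radius_gt0.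
  by split; [exact: bracketing_uniformity|exact: bracketing_glivenko_cantelli].
split; apply: class_ok.
- split; [by exists 0|exact: closedT|].
  by move=> x [_]; rewrite interiorT => /(_ I).
- by move=> S [].
- by move=> S; exact: cone_class_separated.
(* A cone missing the whole space is empty, so its complement excludes no point. *)
- split; first exact: closedT.
  apply/seteqP; split => // x _ [y xi] /= [_].
  by rewrite setIT => ->.
- by move=> S [].
- by move=> S; exact: cone_hull_class_separated.
Qed.
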